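(* Let $C=(C_\bullet,d,s,t)$ be an $H$-unital para-precyclic $k$-module. Let $I:C^\natural_\bullet\to C^{\natural\natural}_\bullet$, $J:C^{\natural\natural}_\bullet\to C^\natural_\bullet$ and $h:C^{\natural\natural}_\bullet\to C^{\natural\natural}_{\bullet+1}$ be the $k$-linear maps given by $$I(xu^0)=xu^0,\qquad I(xu^p)=xu^{2p}+s'Nx\,u^{2p-1}\ (p\ge1),$$ $$J(xu^{2p})=xu^p,\qquad J(xu^{2p+1})=(1-\tau)s'x\,u^p\ (p\ge0),$$ $$h(xu^{2p})=0,\qquad h(xu^{2p+1})=s'x\,u^{2p+1}.$$ (1) $I$ and $J$ are $S$-maps. (2) $JI=1$ and $IJ=1+(\partial+\delta)h+h(\partial+\delta)$. This provides an $S$-deformation retract of $C^{\natural\natural}$ to $C^\natural$. (3) The chain homotopy $h$ is special, i.e. $Jh=0$, $hI=0$ and $h^2=0$.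
   Context: $k$ is a unital ring, not assumed commutative; $k$-modules are left modules. A para-$S$-module $(C_\bullet,d,S,T)$ consists of $k$-modules $C_m$ ($m\ge 0$), $k$-linear maps $d:C_\bullet\to C_{\bullet-1}$, $S:C_\bullet\to C_{\bullet-2}$ and a $k$-linear isomorphism $T:C_\bullet\to C_\bullet$ such that $d^2=S(1-T)$ and $d,S,T$ commute pairwise. An $S$-map is a degree $0$ $k$-linear map commuting with $d,S,T$. An $S$-deformation retract of $C$ to $\bar C$ is given by $S$-maps $f:C_\bullet\to\bar C_\bullet$, $g:\bar C_\bullet\to C_\bullet$ with $fg=1$ and $gf=1+d\varphi+\varphi d$ for a $k$-linear $\varphi$ of degree $+1$ commuting with $S$ and $T$. A para-precyclic $k$-module consists of $k$-modules $C_m$, $m\ge0$, face maps $d_j:C_m\to C_{m-1}$ ($0\le j\le m$) with $d_id_j=d_{j-1}d_i$ for $i<j$, and an invertible $k$-linear map $t:C_\bullet\to C_\bullet$ of degree $0$ with $td_i=d_{i+1}t$ for $0\le i\le m-1$ and $d_m=d_0t$ on $C_m$ (notation: $d=d_m$ on $C_m$). Put $T=t^{m+1}$ on $C_m$; it commutes with $d$ and $t$. Let $b=\sum_{j=0}^m(-1)^jd_j$, $b'=\sum_{j=0}^{m-1}(-1)^jd_j$, $\tau=(-1)^mt$, $N=1+\tau+\cdots+\tau^m$ on $C_m$. It is $H$-unital, written $(C_\bullet,d,s,t)$, when it is equipped with a $k$-linear map $s:C_\bullet\to C_{\bullet+1}$ commuting with $T$ with $b's+sb'=1$. Put $s'=sb's$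 (again a contracting homotopy, with $(s')^2=0$) and $B=(1-\tau)s'N:C_\bullet\to C_{\bullet+1}$. $C^\natural=(C^\natural_\bullet,b+Bu^{-1},u^{-1},T)$, where $C^\natural_m=\bigoplus_{2p\le m}C_{m-2p}u^p$, and $C^{\natural\natural}=(C^{\natural\natural}_\bullet,\partial+\delta,u^{-2},T)$, where $C^{\natural\natural}_m=\bigoplus_{p+q=m}C_qu^p$ ($p,q\ge0$). Here $u$ is a formal variable, $u^{-1}(xu^p)=xu^{p-1}$ for $p\ge1$, $u^{-1}(xu^0)=0$, operators on $C_\bullet$ act on coefficients, and $\partial(xu^{2p+1})=(1-\tau)xu^{2p}$, $\partial(xu^{2p})=Nxu^{2p-1}$ for $p\ge1$, $\partial(xu^0)=0$, $\delta(xu^{2p})=bxu^{2p}$, $\delta(xu^{2p+1})=-b'xu^{2p+1}$. Both are para-$S$-modules. *)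

(* Defs.v *)
From HB Require Import structures.
From mathcomp Require Import all_boot all_algebra zify.
Set Implicit Arguments.
Unset Strict Implicit.
Unset Printing Implicit Defensive.
Import GRing.Theory.
Local Open Scope ring_scope.

(* Graded k-modules are families M : nat -> lmodType k, implicitly extended   *)
(* by M_m = 0 for m < 0.  A map of degree -r is a family M m.+r -> M' m, so   *)
(* an identity between maps ending in negative degree carries no content and  *)
(* is not stated.                                                             *)

Section ParaS.
Variable k : pzRingType.

Record paraSModule := ParaSModule {
  pS_mod :> nat -> lmodType k;
  pS_d : forall m, {linear pS_mod m.+1 -> pS_mod m};
  pS_S : forall m, {linear pS_mod m.+2 -> pS_mod m};
  pS_T : forall m, {linear pS_mod m -> pS_mod m};
  pS_T_bij : forall m, bijective (pS_T m);
  pS_dd : forall m (x : pS_mod m.+2),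
    pS_d m (pS_d m.+1 x) = pS_S m (x - pS_T m.+2 x);
  pS_dS : forall m (x : pS_mod m.+3),
    pS_d m (pS_S m.+1 x) = pS_S m (pS_d m.+2 x);
  pS_dT : forall m (x : pS_mod m.+1),
    pS_d m (pS_T m.+1 x) = pS_T m (pS_d m x);
  pS_ST : forall m (x : pS_mod m.+2),
    pS_S m (pS_T m.+2 x) = pS_T m (pS_S m x)
}.

Definition is_S_map (C C' : paraSModule)
    (f : forall m, {linear C m -> C' m}) : Prop :=
  [/\ forall m (x : C m.+1), f m (pS_d C m x) = pS_d C' m (f m.+1 x),
      forall m (x : C m.+2), f m (pS_S C m x) = pS_S C' m (f m.+2 x)
    & forall m (x : C m), f m (pS_T C m x) = pS_T C' m (f m x)].

(* e = 1 + d phi + phi d; on C_0 the last term vanishes since d = 0 there.    *)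
Definition eq_1_add_boundary (C : paraSModule) (e : forall m, C m -> C m)
    (phi : forall m, {linear C m -> C m.+1}) : Prop :=
  (forall x : C 0, e 0 x = x + pS_d C 0 (phi 0 x)) /\
  (forall m (x : C m.+1),
     e m.+1 x = x + pS_d C m.+1 (phi m.+1 x) + phi m (pS_d C m x)).

(* phi S = S phi on C_m.+2 and on C_1, where it reads 0 = S phi; on C_0 both  *)
(* sides lie in C_(-1) = 0.                                                   *)
Definition commutes_with_S (C : paraSModule)
    (phi : forall m, {linear C m -> C m.+1}) : Prop :=
  (forall x : C 1, pS_S C 0 (phi 1 x) = 0) /\
  (forall m (x : C m.+2), phi m (pS_S C m x) = pS_S C m.+1 (phi m.+2 x)).

Definition commutes_with_T (C : paraSModule)
    (phi : forall m, {linear C m -> C m.+1}) : Prop :=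
  forall m (x : C m), phi m (pS_T C m x) = pS_T C m.+1 (phi m x).

Definition S_deformation_retract (C C' : paraSModule)
    (f : forall m, {linear C m -> C' m}) (g : forall m, {linear C' m -> C m})
    (phi : forall m, {linear C m -> C m.+1}) : Prop :=
  [/\ is_S_map f /\ is_S_map g,
      forall m (x : C' m), f m (g m x) = x,
      eq_1_add_boundary (fun m x => g m (f m x)) phi
    & commutes_with_S phi /\ commutes_with_T phi].

End ParaS.

Section ParaPrecyclic.
Variable k : pzRingType.

(* pc_face m j is d_j on C_m.+1; only its values for j <= m.+1 are used.      *)
Record paraPrecyclic := ParaPrecyclic {
  pc_mod :> nat -> lmodType k;
  pc_face : forall m, nat -> {linear pc_mod m.+1 -> pc_mod m};
  pc_t : forall m, {linear pc_mod m -> pc_mod m};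
  pc_t_bij : forall m, bijective (pc_t m);
  pc_faceK : forall m i j (x : pc_mod m.+2), (i < j <= m.+2)%N ->
    pc_face m i (pc_face m.+1 j x) = pc_face m j.-1 (pc_face m.+1 i x);
  pc_t_face : forall m i (x : pc_mod m.+1), (i <= m)%N ->
    pc_t m (pc_face m i x) = pc_face m i.+1 (pc_t m.+1 x);
  pc_face_last : forall m (x : pc_mod m.+1),
    pc_face m m.+1 x = pc_face m 0 (pc_t m.+1 x)
}.

Section Operators.
Variable C : paraPrecyclic.

Definition pcT m (x : C m) : C m := iter m.+1 (pc_t C m) x.

Definition pc_b m : C m -> C m.-1 :=
  if m is m'.+1 return C m -> C m.-1
  then fun x => \sum_(j < m'.+2) (-1) ^+ j *: pc_face C m' j x
  else fun=> 0.

Definition pc_b' m : C m -> C m.-1 :=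
  if m is m'.+1 return C m -> C m.-1
  then fun x => \sum_(j < m'.+1) (-1) ^+ j *: pc_face C m' j x
  else fun=> 0.

Definition pc_tau m (x : C m) : C m := (-1) ^+ m *: pc_t C m x.

Definition pcN m (x : C m) : C m := \sum_(i < m.+1) iter i (@pc_tau m) x.

End Operators.

(* The condition b's + sb' = 1 is split according to the degree, since b' = 0 *)
(* on C_0.                                                                    *)
Record HunitalParaPrecyclic := HunitalParaPrecyclicMk {
  hu_base :> paraPrecyclic;
  hu_s : forall m, {linear hu_base m -> hu_base m.+1};
  hu_sT : forall m (x : hu_base m), hu_s m (pcT x) = pcT (hu_s m x);
  hu_homotopy0 : forall x : hu_base 0, pc_b' (hu_s 0 x) = x;
  hu_homotopyS : forall m (x : hu_base m.+1),
    pc_b' (hu_s m.+1 x) + hu_s m (pc_b' x) = x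
}.

Definition hu_s' (C : HunitalParaPrecyclic) m (x : C m) : C m.+1 :=
  hu_s C m (pc_b' (hu_s C m x)).

Definition huB (C : HunitalParaPrecyclic) m (x : C m) : C m.+1 :=
  hu_s' (pcN x) - pc_tau (hu_s' (pcN x)).

(* Linearity *)

Fact linear_signZ (U V : lmodType k) (n : nat) (f : {linear U -> V}) :
  linear (fun x => (-1) ^+ n *: f x).
Proof.
move=> a x y; rewrite linearP scalerDr !scalerA.
by congr (_ *: _ + _); apply/esym; apply: commr_sign.
Qed.

Fact linear_sum_ord (U V : lmodType k) n (F : 'I_n -> U -> V) :
  (forall i, linear (F i)) -> linear (fun x => \sum_(i < n) F i x).
Proof.
move=> Flin a x y; rewrite scaler_sumr -big_split.
by apply: eq_bigr => i _; apply: Flin.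
Qed.

Fact linear_iter (U : lmodType k) n (f : {linear U -> U}) : linear (iter n f).
Proof. by move=> a x y; elim: n => //= n ->; rewrite linearP. Qed.

Section Linearity.
Variable C : paraPrecyclic.

Fact pcT_linear m : linear (@pcT C m).
Proof. exact: (linear_iter m.+1 (pc_t C m)). Qed.
HB.instance Definition _ m :=
  GRing.isLinear.Build k (C m) (C m) _ (@pcT C m) (@pcT_linear m).

Fact pc_b_linear m : linear (@pc_b C m).
Proof.
case: m => [|m] a x y /=; first by rewrite scaler0 addr0.
exact: (linear_sum_ord (fun j => linear_signZ j (pc_face C m j))).
Qed.
HB.instance Definition _ m :=
  GRing.isLinear.Build k (C m) (C m.-1) _ (@pc_b C m) (@pc_b_linear m).

Fact pc_b'_linear m : linear (@pc_b' C m).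
Proof.
case: m => [|m] a x y /=; first by rewrite scaler0 addr0.
exact: (linear_sum_ord (fun j => linear_signZ j (pc_face C m j))).
Qed.
HB.instance Definition _ m :=
  GRing.isLinear.Build k (C m) (C m.-1) _ (@pc_b' C m) (@pc_b'_linear m).

Fact pc_tau_linear m : linear (@pc_tau C m).
Proof. exact: (linear_signZ m (pc_t C m)). Qed.
HB.instance Definition _ m :=
  GRing.isLinear.Build k (C m) (C m) _ (@pc_tau C m) (@pc_tau_linear m).

Fact pcN_linear m : linear (@pcN C m).
Proof. exact: (linear_sum_ord (fun i : 'I_m.+1 => linear_iter i (@pc_tau C m))). Qed.
HB.instance Definition _ m :=
  GRing.isLinear.Build k (C m) (C m) _ (@pcN C m) (@pcN_linear m).
End Linearity.

Section LinearityH.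
Variable C : HunitalParaPrecyclic.

Fact hu_s'_linear m : linear (@hu_s' C m).
Proof. by move=> a x y; rewrite /hu_s' !linearP. Qed.
HB.instance Definition _ m :=
  GRing.isLinear.Build k (C m) (C m.+1) _ (@hu_s' C m) (@hu_s'_linear m).

Fact huB_linear m : linear (@huB C m).
Proof.
move=> a x y; rewrite /huB (linearP (@pcN C m)) (linearP (@hu_s' C m)).
by rewrite (linearP (@pc_tau C m.+1)) opprD addrACA scalerBr.
Qed.
HB.instance Definition _ m :=
  GRing.isLinear.Build k (C m) (C m.+1) _ (@huB C m) (@huB_linear m).
End LinearityH.

End ParaPrecyclic.

(* Direct sums  (+)_(p < n) M_(deg p) u^p *)

Definition usum (k : pzRingType) (M : nat -> lmodType k) (n : nat)
  (deg : nat -> nat) := {dffun forall p : 'I_n, M (deg p)}.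

Section USum.
Variables (k : pzRingType) (M : nat -> lmodType k) (n : nat) (deg : nat -> nat).
Local Notation D := (usum M n deg).

HB.instance Definition _ :=
  Choice.copy D {dffun forall p : 'I_n, (M (deg p) : choiceType)}.

Definition usum0 : D := [ffun p => 0].
Definition usum_opp (x : D) : D := [ffun p => - x p].
Definition usum_add (x y : D) : D := [ffun p => x p + y p].
Definition usum_scale (a : k) (x : D) : D := [ffun p => a *: x p].

Fact usum_addA : associative usum_add.
Proof. by move=> x y z; apply/ffunP=> p; rewrite !ffunE addrA. Qed.
Fact usum_addC : commutative usum_add.
Proof. by move=> x y; apply/ffunP=> p; rewrite !ffunE addrC. Qed.
Fact usum_add0 : left_id usum0 usum_add.
Proof. by move=> x; apply/ffunP=> p; rewrite !ffunE add0r. Qed.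
Fact usum_addN : left_inverse usum0 usum_opp usum_add.
Proof. by move=> x; apply/ffunP=> p; rewrite !ffunE addNr. Qed.

HB.instance Definition _ :=
  GRing.isZmodule.Build D usum_addA usum_addC usum_add0 usum_addN.

Fact usum_scaleA a b (x : D) :
  usum_scale a (usum_scale b x) = usum_scale (a * b) x.
Proof. by apply/ffunP=> p; rewrite !ffunE scalerA. Qed.
Fact usum_scale1 : left_id 1 usum_scale.
Proof. by move=> x; apply/ffunP=> p; rewrite !ffunE scale1r. Qed.
Fact usum_scaleDr : right_distributive usum_scale +%R.
Proof. by move=> a x y; apply/ffunP=> p; rewrite !ffunE scalerDr. Qed.
Fact usum_scaleDl (x : D) : {morph usum_scale^~ x : a b / a + b}.
Proof. by move=> a b; apply/ffunP=> p; rewrite !ffunE scalerDl. Qed.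

HB.instance Definition _ := GRing.Zmodule_isLmodule.Build k D
  usum_scaleA usum_scale1 usum_scaleDr usum_scaleDl.

(* The monomial x u^p; it is 0 unless p < n and x lives in degree deg p.      *)
Definition umono (p q : nat) (x : M q) : D :=
  [ffun i : 'I_n =>
    if i == p :> nat then dfwith (fun j => 0 : M j) x (deg i) else 0].

Fact umono_linear p q : linear (@umono p q).
Proof.
move=> a x y; apply/ffunP=> i; rewrite !ffunE.
case: eqP => _; last by rewrite scaler0 addr0.
have [e|ne] := eqVneq q (deg i); last by rewrite !dfwith_out // scaler0 addr0.
by case: (deg i) / e; rewrite !dfwith_in.
Qed.
HB.instance Definition _ p q :=
  GRing.isLinear.Build k (M q) D _ (@umono p q) (@umono_linear p q).

Fact uext_key : unit. Proof. exact: tt. Qed.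

(* The linear map given by x u^p |-> F p x for x in M_(deg p), locked so that *)
(* simplification does not expand it; see uextE.                              *)
Section Extension.
Variables (V : lmodType k) (F : forall p q : nat, M q -> V).
Hypothesis Flin : forall p q, linear (@F p q).

Definition uext_fun of (forall p q, linear (@F p q)) :=
  fun x : D => \sum_(p < n) F p (x p).

Fact uext_linear : linear (uext_fun Flin).
Proof.
apply: (@linear_sum_ord k D V n (fun p (x : D) => F p (x p))) => p a x y.
by rewrite !ffunE Flin.
Qed.
HB.instance Definition _ :=
  GRing.isLinear.Build k D V _ (uext_fun Flin) uext_linear.

Definition uext : {linear D -> V} := 
  locked_with uext_key (uext_fun Flin : {linear D -> V}).

Fact uextE p q (x : M q) :
  uext (umono p x) = if (p < n)%N && (q == deg p) then F p x else 0.
Proof.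
have F0 i j : @F i j 0 = 0.
  by have := @Flin i j (-1) 0 0; rewrite scaler0 addr0 scaleN1r addNr.
rewrite /uext unlock /= /uext_fun; case: ltnP => [ltpn | lenp] /=; last first.
  rewrite big1 // => i _; rewrite ffunE.
  by rewrite (ltn_eqF (leq_trans (ltn_ord i) lenp)) F0.
rewrite (bigD1 (Ordinal ltpn)) //= big1 => [|i neqip].
  rewrite addr0 !ffunE eqxx; have [e | ne] := eqVneq q (deg p).
    by subst q; rewrite dfwith_in.
  by rewrite dfwith_out ?F0.
by rewrite !ffunE (negPf neqip : (i == p :> nat) = false) F0.
Qed.

End Extension.

Fact usum_mono (x : D) : x = \sum_(p < n) umono p (x p).
Proof.
have sumE (y : 'I_n -> D) i : (\sum_p y p) i = \sum_p y p i.
  by apply: (big_morph (fun z : D => z i)) => [u v|]; rewrite ffunE.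
apply/ffunP=> i; rewrite sumE (bigD1 i) //= big1 => [|p neqpi].
  by rewrite addr0 ffunE eqxx dfwith_in.
by rewrite ffunE eq_sym (negPf neqpi : (p == i :> nat) = false).
Qed.

Fact usum_ext (V : lmodType k) (f g : {linear D -> V}) :
  (forall p (x : M (deg p)), (p < n)%N -> f (umono p x) = g (umono p x)) ->
  f =1 g.
Proof.
move=> fg x; rewrite (usum_mono x).
by rewrite !linear_sum; apply: eq_bigr => p _; apply: fg.
Qed.

End USum.

Arguments umono {k M n deg} p {q} x.
Arguments uext {k M n deg V F}.
Notation "x *u^ p" := (umono p x) (at level 40, p at level 9) : ring_scope.

Section Cyclic.
Variables (k : pzRingType) (C : HunitalParaPrecyclic k).

(* Cnat is the paper's C^natural and Cnatnat its C^natural-natural.  The      *)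
(* coefficient of u^p in total degree m lies in C_(m - 2p), resp. C_(m - p).  *)
(* The terms f_mono m p x below are f(x u^p) in total degree m, where in b x  *)
(* and b' x the degree q.-1 is harmless for q = 0 since b = b' = 0 there.     *)
Definition Cnat_mod m : lmodType k := usum C (m./2).+1 (fun p => m - p.*2)%N.
Definition Cnatnat_mod m : lmodType k := usum C m.+1 (fun p => m - p)%N.

Definition Cnat_d_mono m p q (x : C q) : Cnat_mod m :=
  pc_b x *u^ p + (if p is p'.+1 then huB x *u^ p' else 0).
Definition Cnat_uinv_mono m p q (x : C q) : Cnat_mod m :=
  if p is p'.+1 then x *u^ p' else 0.
Definition Cnat_T_mono m p q (x : C q) : Cnat_mod m := pcT x *u^ p.

Definition Cnatnat_partial m p q (x : C q) : Cnatnat_mod m :=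
  if p is p'.+1 then (if odd p then x - pc_tau x else pcN x) *u^ p' else 0.
Definition Cnatnat_delta m p q (x : C q) : Cnatnat_mod m :=
  if odd p then - (pc_b' x *u^ p) else pc_b x *u^ p.
Definition Cnatnat_d_mono m p q (x : C q) : Cnatnat_mod m :=
  Cnatnat_partial m p x + Cnatnat_delta m p x.
Definition Cnatnat_uinv2_mono m p q (x : C q) : Cnatnat_mod m :=
  if p is p'.+2 then x *u^ p' else 0.
Definition Cnatnat_T_mono m p q (x : C q) : Cnatnat_mod m := pcT x *u^ p.

Definition I_mono m p q (x : C q) : Cnatnat_mod m :=
  if p is 0 then x *u^ 0 else x *u^ p.*2 + hu_s' (pcN x) *u^ (p.*2.-1).
Definition J_mono m p q (x : C q) : Cnat_mod m :=
  if odd p then (hu_s' x - pc_tau (hu_s' x)) *u^ (p./2) else x *u^ (p./2).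
Definition h_mono m p q (x : C q) : Cnatnat_mod m.+1 :=
  if odd p then hu_s' x *u^ p else 0.

Fact Cnat_d_linear m p q : linear (@Cnat_d_mono m p q).
Proof.
move=> a x y; rewrite /Cnat_d_mono !linearP scalerDr addrACA; congr (_ + _).
by case: p => [|p]; rewrite ?linearP ?scaler0 ?addr0.
Qed.
Fact Cnat_uinv_linear m p q : linear (@Cnat_uinv_mono m p q).
Proof. by case: p => [|p] a x y /=; rewrite ?linearP ?scaler0 ?addr0. Qed.
Fact Cnat_T_linear m p q : linear (@Cnat_T_mono m p q).
Proof. by move=> a x y; rewrite /Cnat_T_mono !linearP. Qed.

Fact sub_tau_linear q : linear (fun x : C q => x - pc_tau x).
Proof. by move=> a x y; rewrite linearP opprD addrACA scalerBr. Qed.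

Fact Cnatnat_d_linear m p q : linear (@Cnatnat_d_mono m p q).
Proof.
move=> a x y; rewrite /Cnatnat_d_mono scalerDr addrACA; congr (_ + _).
  case: p => [|p] /=; first by rewrite scaler0 addr0.
  by case: (odd p); rewrite ?sub_tau_linear !linearP.
rewrite /Cnatnat_delta; by case: (odd p); rewrite !linearP.
Qed.
Fact Cnatnat_uinv2_linear m p q : linear (@Cnatnat_uinv2_mono m p q).
Proof. by case: p => [|[|p]] a x y /=; rewrite ?linearP ?scaler0 ?addr0. Qed.
Fact Cnatnat_T_linear m p q : linear (@Cnatnat_T_mono m p q).
Proof. by move=> a x y; rewrite /Cnatnat_T_mono !linearP. Qed.

Fact I_linear m p q : linear (@I_mono m p q).
Proof.
case: p => [|p] a x y; first by rewrite /= linearP.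
by rewrite /I_mono !linearP scalerDr addrACA.
Qed.
Fact J_linear m p q : linear (@J_mono m p q).
Proof.
move=> a x y; rewrite /J_mono; case: (odd p); last exact: linearP.
by rewrite (linearP (@hu_s' k C q)) sub_tau_linear linearP.
Qed.
Fact h_linear m p q : linear (@h_mono m p q).
Proof.
move=> a x y; rewrite /h_mono; case: (odd p); last by rewrite scaler0 addr0.
by rewrite !linearP.
Qed.

Definition Cnat_d m : {linear Cnat_mod m.+1 -> Cnat_mod m} :=
  uext (@Cnat_d_linear m).
Definition Cnat_uinv m : {linear Cnat_mod m.+2 -> Cnat_mod m} :=
  uext (@Cnat_uinv_linear m).
Definition Cnat_T m : {linear Cnat_mod m -> Cnat_mod m} :=
  uext (@Cnat_T_linear m).

Definition Cnatnat_d m : {linear Cnatnat_mod m.+1 -> Cnatnat_mod m} :=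
  uext (@Cnatnat_d_linear m).
Definition Cnatnat_uinv2 m : {linear Cnatnat_mod m.+2 -> Cnatnat_mod m} :=
  uext (@Cnatnat_uinv2_linear m).
Definition Cnatnat_T m : {linear Cnatnat_mod m -> Cnatnat_mod m} :=
  uext (@Cnatnat_T_linear m).

Definition mapI m : {linear Cnat_mod m -> Cnatnat_mod m} :=
  uext (@I_linear m).
Definition mapJ m : {linear Cnatnat_mod m -> Cnat_mod m} :=
  uext (@J_linear m).
Definition maph m : {linear Cnatnat_mod m -> Cnatnat_mod m.+1} :=
  uext (@h_linear m).

End Cyclic.

Section ParaPrecyclicTheory.
Variables (k : pzRingType) (C : paraPrecyclic k).

Let e m i (x : C m.+1) : C m := (-1) ^+ i *: pc_face C m i x.

Local Notation tau := (@pc_tau k C _).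

Let it0 m j : iter j (@pc_tau k C m) 0 = 0.
Proof. by elim: j => //= j ->; rewrite linear0. Qed.

Let e_tau m i (x : C m.+1) : (i <= m)%N -> e i.+1 (tau x) = tau (e i x).
Proof.
move=> leim; rewrite /e /pc_tau !linearZ /= -pc_t_face // !scalerA.
by rewrite -!exprD; congr (_ *: _); rewrite addSn addnS !exprS !mulN1r opprK addnC.
Qed.

Let e0_tau m (x : C m.+1) : e 0 (tau x) = e m.+1 x.
Proof. by rewrite /e /pc_tau scale1r !linearZ /= -pc_face_last. Qed.

Let e_iter m i j (x : C m.+1) : (j <= i <= m.+1)%N ->
  e i (iter j tau x) = iter j tau (e (i - j) x).
Proof.
elim: j i => [|j IHj] [|i] // /andP[leji leim]; rewrite subSS /=.
by rewrite e_tau // IHj // -ltnS leji leqW.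
Qed.

Let e_iter_wrap m i j (x : C m.+1) : (i <= m.+1)%N -> (j <= m.+1)%N ->
  e i (iter (i + j.+1) tau x) = iter (i + j) tau (e (m.+1 - j) x).
Proof.
move=> leim lejm; rewrite !iterD e_iter ?leqnn // subnn /= e0_tau.
by rewrite e_iter ?lejm ?leqnn.
Qed.

Fact pcT_tau m (x : C m) : pcT x = iter m.+1 tau x.
Proof.
have iterE n : iter n tau x = (-1) ^+ (m * n) *: iter n (pc_t C m) x.
  elim: n => [|n IHn]; first by rewrite muln0 scale1r.
  by rewrite !iterS IHn /pc_tau linearZ /= scalerA -exprD mulnS.
rewrite iterE -[(-1) ^+ _]signr_odd oddM /= andbN scale1r //.
Qed.

Fact pcT_tauC m (x : C m) : pcT (tau x) = tau (pcT x).
Proof. by rewrite !pcT_tau -iterSr. Qed.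

Let eT m i (x : C m.+1) : (i <= m.+1)%N -> e i (pcT x) = pcT (e i x).
Proof.
move=> leim; rewrite !pcT_tau.
have {1}->: m.+2 = (i + (m.+1 - i).+1)%N by rewrite addnS subnKC.
by rewrite e_iter_wrap ?leq_subr // subnKC // subKn.
Qed.

Fact pc_bT m (x : C m) : pc_b (pcT x) = pcT (pc_b x).
Proof.
case: m x => [|m] x /=; first by rewrite linear0.
by rewrite linear_sum; apply: eq_bigr => i _; apply: eT; rewrite -ltnS.
Qed.

Fact pc_b'T m (x : C m) : pc_b' (pcT x) = pcT (pc_b' x).
Proof.
case: m x => [|m] x /=; first by rewrite linear0.
by rewrite linear_sum; apply: eq_bigr => i _; apply: eT; rewrite ltnW.
Qed.

Fact pcNT m (x : C m) : pcN (pcT x) = pcT (pcN x).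
Proof.
rewrite linear_sum; apply: eq_bigr => i _ /=.
by elim: {i}(i : nat) => //= i ->; rewrite pcT_tauC.
Qed.

Fact pcN_tau m (x : C m) : pcN x - tau (pcN x) = x - pcT x.
Proof.
rewrite linear_sum pcT_tau {1}/pcN big_ord_recl /= [X in _ - X]big_ord_recr /=.
by rewrite opprD addrA addrK.
Qed.

Fact pcN_subtau m (x : C m) : pcN (x - tau x) = x - pcT x.
Proof.
rewrite -pcN_tau linearB; congr (_ - _); rewrite linear_sum.
by apply: eq_bigr => i _; rewrite -iterSr.
Qed.

Fact pc_b_subtau m (x : C m) : pc_b (x - tau x) = pc_b' x - tau (pc_b' x).
Proof.
case: m x => [|m] x; first by rewrite /= linear0 subrr.
have bE (y : C m.+1) : pc_b y = \sum_(j < m.+2) e j y by [].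
have -> : pc_b (x - tau x) = pc_b x - pc_b (tau x) by exact: linearB.
rewrite !bE.
rewrite big_ord_recr [X in _ - X]big_ord_recl /= e0_tau opprD addrA addrK.
congr (_ - _); rewrite linear_sum.
by apply: eq_bigr => i _; rewrite e_tau // -ltnS.
Qed.

Fact pc_b'N m (x : C m) : pc_b' (pcN x) = pcN (pc_b x).
Proof.
case: m x => [|m] x /=; first by rewrite linear0.
transitivity (\sum_(i < m.+1) \sum_(j < m.+1)
   iter j tau (if (j <= i)%N then e (i - j) x else 0)
  + \sum_(i < m.+1) \sum_(j < m.+1)
   iter j tau (if (i <= j)%N then e (m.+1 + i - j) x else 0)).
  rewrite -big_split; apply: eq_bigr => -[i lti] _ /=.
  rewrite -/(e i _) /pcN.
  have -> : e i (\sum_(j < m.+2) iter j tau x)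
      = \sum_(j < m.+2) e i (iter j tau x).
    by rewrite /e linear_sum scaler_sumr.
  rewrite -(big_mkord xpredT (fun j => e i (iter j tau x))).
  rewrite (big_cat_nat (n:=i.+1)) ?ltnS ?(ltnW lti) //=.
  rewrite -(big_mkord xpredT
    (fun j => iter j tau (if (j <= i)%N then e (i - j) x else 0))).
  rewrite -(big_mkord xpredT
    (fun j => iter j tau (if (i <= j)%N then e (m.+1 + i - j) x else 0))).
  congr (_ + _).
    rewrite [RHS](big_cat_nat (n:=i.+1)) //= [X in _ = _ + X]big_nat_cond.
    rewrite [X in _ = _ + X]big1 ?addr0; last first.
      by move=> j /andP[/andP[ltij _] _]; rewrite leqNgt ltij it0.
    rewrite big_nat_cond [RHS]big_nat_cond; apply: eq_bigr => j.
    rewrite andbT ltnS => /andP[_ leji].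
    by rewrite leji e_iter ?leji // ltnW.
  rewrite [RHS](big_cat_nat (n:=i)) ?(ltnW lti) //= [X in _ = X + _]big_nat_cond.
  rewrite [X in _ = X + _]big1 ?add0r; last first.
    by move=> j /andP[/andP[_ ltji] _]; rewrite leqNgt ltji it0.
  rewrite big_add1 /= big_nat_cond [RHS]big_nat_cond; apply: eq_bigr => j.
  rewrite andbT => /andP[leij ltjm]; rewrite leij.
  have -> : tau (iter j tau x) = iter (i + (j - i).+1) tau x.
    by rewrite addnS subnKC.
  rewrite e_iter_wrap ?subnKC ?(ltnW lti) //; first last.
    by rewrite (leq_trans (leq_subr _ _)) // ltnW.
  by congr (iter _ _ (e _ _)); rewrite subnBA.
rewrite exchange_big /= [X in _ + X]exchange_big /= -big_split /pcN /=; apply: eq_bigr => -[j ltj] _ /=.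
have itL := linear_iter j (@pc_tau k C m).
pose F := fun y => iter j (@pc_tau k C m) y.
have F0 : F 0 = 0 by exact: it0.
have FD : {morph F : y z / y + z}.
  by move=> y z; have := itL 1 y z; rewrite !scale1r.
rewrite -!(big_morph F FD F0) -FD; congr (F _).
rewrite -!big_mkcond -(big_mkord (fun i => j <= i)%N (fun i => e (i - j) x)).
rewrite -(big_mkord (fun i => i <= j)%N (fun i => e (m.+1 + i - j) x)).
rewrite -(big_mkord xpredT (fun i => e i x)).
rewrite [RHS](big_cat_nat (n:=(m.+1 - j))) ?(leq_trans (leq_subr _ _)) //=.
congr (_ + _).
  rewrite (big_cat_nat (n:=j)) ?(ltnW ltj) //= big_nat_cond big_pred0 ?add0r.
    rewrite -{1}[j]add0n big_addn; rewrite [LHS]big_nat_cond [RHS]big_nat_cond.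
    by apply: eq_big => [i|i _]; rewrite ?addnK // leq_addl andbT.
  by move=> i; apply/negP => /andP[/andP[_]]; rewrite ltnNge => /negP.
rewrite (big_cat_nat (n:=j.+1)) //= [X in _ + X]big_nat_cond.
rewrite [X in _ + X]big_pred0 ?addr0; last first.
  by move=> i; apply/negP => /andP[/andP[+ _]]; rewrite ltnNge => /negP.
rewrite -{1}[(m.+1 - j)%N]add0n big_addn.
have -> : (m.+2 - (m.+1 - j) = j.+1)%N by rewrite subSn ?leq_subr // subKn // ltnW.
rewrite [LHS]big_nat_cond [RHS]big_nat_cond.
apply: eq_big => [i|i _]; first by rewrite ltnS andbT; case: (i <= j)%N.
by congr (e _ _); rewrite addnC addnBA // ltnW.
Qed.

Let pc_bn n m (x : C m.+2) : (n <= m.+2)%N ->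
  \sum_(i < n) e i (\sum_(j < n.+1) e j x) = 0.
Proof.
move=> lenm.
have -> : \sum_(i < n) e i (\sum_(j < n.+1) e j x)
   = \sum_(i < n) \sum_(j < n.+1) e i (e j x).
  by apply: eq_bigr => i _; rewrite {1}/e linear_sum scaler_sumr.
have ee i j : (i < j <= m.+2)%N -> e i (e j x) = - e j.-1 (e i x).
  case: j => // j lij; rewrite /e !linearZ /= pc_faceK //= !scalerA -!exprD.
  by rewrite addnS exprS mulN1r scaleNr addnC -scalerN.
elim: n lenm => [|n IHn] lenm; first by rewrite big_ord0.
rewrite big_ord_recr /=.
under eq_bigr do rewrite big_ord_recr /=.
rewrite big_split /= IHn ?add0r 1?ltnW // big_ord_recr /=.
rewrite addrA; set a := e n (e n.+1 x).
have -> : a = - e n (e n x) by rewrite /a ee // ltnSn.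
rewrite [X in _ + X + _]big_ord_recr /= addrA addrK -big_split big1 // => i _.
by rewrite (@ee i n.+1) ?ltnS ?(ltnW (ltn_ord i)) //= addNr.
Qed.

Fact pc_bb m (x : C m) : pc_b (pc_b x) = 0.
Proof. by case: m x => [|[|m]] x //=; rewrite ?linear0 //; exact: pc_bn. Qed.

Fact pc_b'b' m (x : C m) : pc_b' (pc_b' x) = 0.
Proof. by case: m x => [|[|m]] x //=; rewrite ?linear0 //; apply: pc_bn. Qed.

Fact pcT_bij m : bijective (@pcT k C m).
Proof.
rewrite /pcT; elim: {1}m.+1 => [|n IHn]; first by exists id.
exact: (bij_comp (pc_t_bij C m) IHn).
Qed.
End ParaPrecyclicTheory.

#[local] Arguments pc_b : simpl never.
#[local] Arguments pc_b' : simpl never.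

Section HunitalTheory.
Variables (k : pzRingType) (C : HunitalParaPrecyclic k).

Let b'sb's m (x : C m) : pc_b' (hu_s C m (pc_b' (hu_s C m x))) = pc_b' (hu_s C m x).
Proof.
case: m x => [|m] x; first by rewrite !hu_homotopy0.
by rewrite -[RHS]hu_homotopyS (pc_b'b' (hu_s C m.+1 x)) linear0 addr0.
Qed.

Fact hu_s'_b' m (x : C m.+1) : hu_s' (pc_b' x : C m) = hu_s C m (pc_b' x).
Proof.
have b'D (y z : C m.+1) : pc_b' (y + z) = pc_b' y + pc_b' z by exact: linearD.
congr (hu_s C m _); rewrite -[x in RHS]hu_homotopyS b'D.
by rewrite (pc_b'b' (hu_s C m.+1 x)) add0r.
Qed.

Fact hu_s'_homotopy0 (x : C 0) : pc_b' (hu_s' x) = x.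
Proof. by rewrite /hu_s' b'sb's hu_homotopy0. Qed.

Fact hu_s'_homotopyS m (x : C m.+1) : pc_b' (hu_s' x) + hu_s' (pc_b' x : C m) = x.
Proof. by rewrite {1}/hu_s' b'sb's hu_s'_b' hu_homotopyS. Qed.

Fact hu_s's' m (x : C m) : hu_s' (hu_s' x) = 0.
Proof.
pose w : C m := pc_b' (hu_s C m x); rewrite {1}/hu_s'.
have -> : hu_s' x = hu_s C m w by [].
have := hu_homotopyS (hu_s C m w).
have -> : hu_s C m (pc_b' (hu_s C m w)) = hu_s C m w by rewrite b'sb's.
by move/(canRL (addrK _)) ->; rewrite subrr linear0.
Qed.

Fact hu_s'T m (x : C m) : hu_s' (pcT x) = pcT (hu_s' x).
Proof. by rewrite /hu_s' hu_sT pc_b'T hu_sT. Qed.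

Fact huBT m (x : C m) : huB (pcT x) = pcT (huB x).
Proof. by rewrite /huB pcNT hu_s'T -pcT_tauC -linearB. Qed.

Fact hu_s'N_subtau m (x : C m) :
  hu_s' (pcN (hu_s' x - pc_tau (hu_s' x))) = 0.
Proof. by rewrite pcN_subtau linearB /= hu_s'T hu_s's' linear0 subrr. Qed.

Fact huBB m (x : C m) : huB (huB x) = 0.
Proof. by rewrite {1}/huB hu_s'N_subtau linear0 subrr. Qed.

Fact pc_b_huB0 (x : C 0) : pc_b (huB x) = x - pcT x.
Proof. by rewrite pc_b_subtau hu_s'_homotopy0 pcN_tau. Qed.

Fact pc_b_huB m (x : C m.+1) : pc_b (huB x) + huB (pc_b x : C m) = x - pcT x.
Proof.
rewrite pc_b_subtau {1}/huB -(pc_b'N x) addrACA -opprD -linearD /=.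
by rewrite hu_s'_homotopyS pcN_tau.
Qed.

Fact Cnat_ext m (V : lmodType k) (f g : {linear Cnat_mod C m -> V}) :
  (forall p q (x : C q), (p.*2 + q)%N = m -> f (x *u^ p) = g (x *u^ p)) ->
  f =1 g.
Proof. by move=> fg; apply: usum_ext => p x ltp; apply: fg; lia. Qed.

Fact Cnatnat_ext m (V : lmodType k) (f g : {linear Cnatnat_mod C m -> V}) :
  (forall p q (x : C q), (p + q)%N = m -> f (x *u^ p) = g (x *u^ p)) ->
  f =1 g.
Proof. by move=> fg; apply: usum_ext => p x ltp; apply: fg; lia. Qed.

Section OnMonomials.
Variables (m p q : nat) (x : C q).

Fact Cnat_dE : (p.*2 + q)%N = m.+1 -> Cnat_d C m (x *u^ p) = Cnat_d_mono m p x.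
Proof. by move=> e; rewrite uextE ifT //; lia. Qed.
Fact Cnat_uinvE : (p.*2 + q)%N = m.+2 ->
  Cnat_uinv C m (x *u^ p) = Cnat_uinv_mono m p x.
Proof. by move=> e; rewrite uextE ifT //; lia. Qed.
Fact Cnat_TE : (p.*2 + q)%N = m -> Cnat_T C m (x *u^ p) = Cnat_T_mono m p x.
Proof. by move=> e; rewrite uextE ifT //; lia. Qed.

Fact Cnatnat_dE : (p + q)%N = m.+1 ->
  Cnatnat_d C m (x *u^ p) = Cnatnat_d_mono m p x.
Proof. by move=> e; rewrite uextE ifT //; lia. Qed.
Fact Cnatnat_uinv2E : (p + q)%N = m.+2 ->
  Cnatnat_uinv2 C m (x *u^ p) = Cnatnat_uinv2_mono m p x.
Proof. by move=> e; rewrite uextE ifT //; lia. Qed.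
Fact Cnatnat_TE : (p + q)%N = m -> Cnatnat_T C m (x *u^ p) = Cnatnat_T_mono m p x.
Proof. by move=> e; rewrite uextE ifT //; lia. Qed.

Fact mapIE : (p.*2 + q)%N = m -> mapI C m (x *u^ p) = I_mono m p x.
Proof. by move=> e; rewrite uextE ifT //; lia. Qed.
Fact mapJE : (p + q)%N = m -> mapJ C m (x *u^ p) = J_mono m p x.
Proof. by move=> e; rewrite uextE ifT //; lia. Qed.
Fact maphE : (p + q)%N = m -> maph C m (x *u^ p) = h_mono m p x.
Proof. by move=> e; rewrite uextE ifT //; lia. Qed.

End OnMonomials.

Let pcT_ffun n deg (x : usum C n deg) :
  \sum_(p < n) (pcT (x p) *u^ p : usum C n deg) = [ffun p => pcT (x p)].
Proof.
rewrite [RHS]usum_mono; apply: eq_bigr => p _; congr (_ *u^ _).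
by rewrite ffunE.
Qed.

Let pcT_ffun_bij n deg (f : usum C n deg -> usum C n deg) :
  f =1 (fun x => [ffun p => pcT (x p)]) -> bijective f.
Proof.
move=> fE; have surT m (y : C m) : exists x, pcT x == y.
  by have [g _ gK] := pcT_bij C m; exists (g y); rewrite gK.
pose g (y : usum C n deg) : usum C n deg :=
  [ffun p => xchoose (surT _ (y p))].
exists g => x; rewrite /g.
  apply/ffunP=> p; rewrite fE !ffunE; apply: (bij_inj (pcT_bij C _)).
  by apply/eqP; rewrite (eqP (xchooseP (surT _ _))) ?ffunE.
by rewrite fE; apply/ffunP=> p; rewrite !ffunE (eqP (xchooseP (surT _ _))).
Qed.

Fact Cnat_T_bij m : bijective (Cnat_T C m).
Proof. by apply: pcT_ffun_bij => x; rewrite -pcT_ffun /Cnat_T /uext unlock. Qed.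

Fact Cnatnat_T_bij m : bijective (Cnatnat_T C m).
Proof. by apply: pcT_ffun_bij => x; rewrite -pcT_ffun /Cnatnat_T /uext unlock. Qed.

Fact Cnat_dd m (x : Cnat_mod C m.+2) :
  Cnat_d C m (Cnat_d C m.+1 x) = Cnat_uinv C m (x - Cnat_T C m.+2 x).
Proof.
move: x; apply: (Cnat_ext (f := Cnat_d C m \o Cnat_d C m.+1)
  (g := Cnat_uinv C m \o (idfun \- Cnat_T C m.+2))) => p q x e /=.
rewrite linearB Cnat_dE // Cnat_TE // {1}/Cnat_d_mono linearD /=.
rewrite /Cnat_T_mono !Cnat_uinvE //.
case: p e => [|p] e /=.
  rewrite linear0 addr0 subrr; case: q x e => [|q] x e.
    by rewrite (erefl : pc_b x = 0) !linear0.
  rewrite (Cnat_dE (pc_b x : C q)); last by lia.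
  by rewrite /Cnat_d_mono addr0 (pc_bb x) linear0.
rewrite (@Cnat_dE _ p); last by lia.
rewrite /Cnat_d_mono; have -> : (if p is p'.+1 return Cnat_mod C m
    then huB (huB x) *u^ p' else 0) = 0 by case: (p) => // p'; rewrite huBB linear0.
rewrite addr0 -linearB /=; case: q x e => [|q] x e.
  by rewrite pc_b_huB0 !linear0 add0r.
rewrite (@Cnat_dE _ p.+1) /=; last by lia.
by rewrite /Cnat_d_mono (pc_bb x) linear0 add0r -linearD /= addrC pc_b_huB.
Qed.

Fact Cnat_dS m (x : Cnat_mod C m.+3) :
  Cnat_d C m (Cnat_uinv C m.+1 x) = Cnat_uinv C m (Cnat_d C m.+2 x).
Proof.
move: x; apply: (Cnat_ext (f := Cnat_d C m \o Cnat_uinv C m.+1)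
  (g := Cnat_uinv C m \o Cnat_d C m.+2)) => p q x e /=.
rewrite Cnat_uinvE // Cnat_dE // /Cnat_d_mono linearD.
case: p e => [|p] e /=.
  rewrite !linear0 addr0; case: q x e => [|q] x e //.
  by rewrite Cnat_uinvE //; lia.
rewrite Cnat_dE /Cnat_d_mono; last by lia.
rewrite (@Cnat_uinvE _ p); last by lia.
rewrite -[RHS]/(_ + Cnat_uinv_mono m p (huB x)); congr (_ + _).
case: q x e => [|q] x e; first by rewrite (erefl : pc_b x = 0) !linear0.
by rewrite Cnat_uinvE //; lia.
Qed.

Fact Cnat_dT m (x : Cnat_mod C m.+1) :
  Cnat_d C m (Cnat_T C m.+1 x) = Cnat_T C m (Cnat_d C m x).
Proof.
move: x; apply: (Cnat_ext (f := Cnat_d C m \o Cnat_T C m.+1)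
  (g := Cnat_T C m \o Cnat_d C m)) => p q x e /=.
rewrite Cnat_TE // Cnat_dE // /Cnat_T_mono Cnat_dE // /Cnat_d_mono linearD pc_bT.
congr (_ + _).
  case: q x e => [|q] x e; first by rewrite (erefl : pc_b x = 0) !linear0.
  by rewrite Cnat_TE //; lia.
case: p e => [|p] e; first by rewrite linear0.
by rewrite huBT Cnat_TE //; lia.
Qed.

Fact Cnat_ST m (x : Cnat_mod C m.+2) :
  Cnat_uinv C m (Cnat_T C m.+2 x) = Cnat_T C m (Cnat_uinv C m x).
Proof.
move: x; apply: (Cnat_ext (f := Cnat_uinv C m \o Cnat_T C m.+2)
  (g := Cnat_T C m \o Cnat_uinv C m)) => p q x e /=.
rewrite Cnat_TE // Cnat_uinvE // /Cnat_T_mono Cnat_uinvE //.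
by case: p e => [|p] e /=; rewrite ?linear0 // Cnat_TE //; lia.
Qed.


Let lin0 (U V : lmodType k) (f : U -> V) : linear f -> f 0 = 0.
Proof. by move/(_ (-1) 0 0); rewrite scaler0 addr0 scaleN1r addNr. Qed.

Let Cnatnat_dEb m p q (x : C q) : (p + q)%N = m.+2 ->
  Cnatnat_d C m (pc_b x *u^ p) = Cnatnat_d_mono m p (pc_b x).
Proof.
case: q x => [|q] x e; last by rewrite Cnatnat_dE //; lia.
by rewrite (erefl : pc_b x = 0) !linear0 (lin0 (@Cnatnat_d_linear _ C m p 0)).
Qed.

Let Cnatnat_dEb' m p q (x : C q) : (p + q)%N = m.+2 ->
  Cnatnat_d C m (pc_b' x *u^ p) = Cnatnat_d_mono m p (pc_b' x).
Proof.
case: q x => [|q] x e; last by rewrite Cnatnat_dE //; lia.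
by rewrite (erefl : pc_b' x = 0) !linear0 (lin0 (@Cnatnat_d_linear _ C m p 0)).
Qed.

Fact Cnatnat_dd m (x : Cnatnat_mod C m.+2) :
  Cnatnat_d C m (Cnatnat_d C m.+1 x) = Cnatnat_uinv2 C m (x - Cnatnat_T C m.+2 x).
Proof.
move: x; apply: (Cnatnat_ext (f := Cnatnat_d C m \o Cnatnat_d C m.+1)
  (g := Cnatnat_uinv2 C m \o (idfun \- Cnatnat_T C m.+2))) => p q x e /=.
rewrite linearB Cnatnat_dE // Cnatnat_TE // {1}/Cnatnat_d_mono linearD /=.
rewrite /Cnatnat_T_mono !Cnatnat_uinv2E //.
case: p e => [|[|p]] e; rewrite /Cnatnat_partial /Cnatnat_delta /=.
- rewrite linear0 add0r subrr Cnatnat_dEb // /Cnatnat_d_mono /Cnatnat_partial.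
  by rewrite add0r /Cnatnat_delta /= pc_bb linear0.
- rewrite subrr linearN Cnatnat_dEb' // Cnatnat_dE; last by lia.
  rewrite /Cnatnat_d_mono /Cnatnat_partial /Cnatnat_delta /= add0r.
  by rewrite pc_b'b' linear0 oppr0 addr0 pc_b_subtau subrr.
rewrite negbK; case: ifP => podd.
  rewrite linearN Cnatnat_dEb' // Cnatnat_dE; last by lia.
  rewrite /Cnatnat_d_mono /Cnatnat_partial /Cnatnat_delta /= podd /=.
  rewrite pc_b'b' linear0 oppr0 addr0 pc_b_subtau addrK pcN_subtau.
  by rewrite linearB.
rewrite Cnatnat_dEb // Cnatnat_dE; last by lia.
rewrite /Cnatnat_d_mono /Cnatnat_partial /Cnatnat_delta /= podd /=.
by rewrite pc_bb linear0 addr0 pc_b'N addrNK pcN_tau linearB.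
Qed.

Fact Cnatnat_dS m (x : Cnatnat_mod C m.+3) :
  Cnatnat_d C m (Cnatnat_uinv2 C m.+1 x) = Cnatnat_uinv2 C m (Cnatnat_d C m.+2 x).
Proof.
move: x; apply: (Cnatnat_ext (f := Cnatnat_d C m \o Cnatnat_uinv2 C m.+1)
  (g := Cnatnat_uinv2 C m \o Cnatnat_d C m.+2)) => p q x e /=.
have uinvb (y : C q.-1) : (q = 0 -> y = 0) ->
    Cnatnat_uinv2 C m (y *u^ p) = Cnatnat_uinv2_mono m p y.
  case: q x y e => [|q] x y e y0; last by rewrite Cnatnat_uinv2E //; lia.
  by rewrite y0 // !linear0 (lin0 (@Cnatnat_uinv2_linear _ C m p 0)).
have b0 : q = 0 -> pc_b x = 0 by move=> q0; subst q.
have b'0 : q = 0 -> pc_b' x = 0 by move=> q0; subst q.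
rewrite Cnatnat_uinv2E // Cnatnat_dE // /Cnatnat_d_mono linearD.
case: p e uinvb => [|[|p]] e uinvb.
- by rewrite !linear0 add0r /Cnatnat_delta /= uinvb.
- rewrite /Cnatnat_partial /Cnatnat_delta /= linearN uinvb //= oppr0 addr0.
  by rewrite Cnatnat_uinv2E ?linear0 //; lia.
rewrite Cnatnat_dE; last by lia.
rewrite /Cnatnat_d_mono; congr (_ + _).
  rewrite /Cnatnat_partial /= negbK.
  rewrite Cnatnat_uinv2E; last by lia.
  by case: p {e uinvb} => [|p] //=; rewrite ?negbK.
rewrite /Cnatnat_delta /= negbK; case: ifP => _; last by rewrite uinvb.
by rewrite linearN uinvb.
Qed.

Fact Cnatnat_dT m (x : Cnatnat_mod C m.+1) :
  Cnatnat_d C m (Cnatnat_T C m.+1 x) = Cnatnat_T C m (Cnatnat_d C m x).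
Proof.
move: x; apply: (Cnatnat_ext (f := Cnatnat_d C m \o Cnatnat_T C m.+1)
  (g := Cnatnat_T C m \o Cnatnat_d C m)) => p q x e /=.
rewrite Cnatnat_TE // Cnatnat_dE // /Cnatnat_T_mono Cnatnat_dE //.
rewrite /Cnatnat_d_mono linearD; congr (_ + _).
  case: p e => [|p] e; first by rewrite linear0.
  rewrite /Cnatnat_partial Cnatnat_TE; last by lia.
  rewrite /Cnatnat_T_mono; congr (_ *u^ _).
  by case: ifP => _; rewrite ?pcNT // -pcT_tauC -linearB.
have Tb (y : C q.-1) : (q = 0 -> y = 0) ->
    Cnatnat_T C m (y *u^ p) = pcT y *u^ p.
  case: q x y e => [|q] x y e y0; last by rewrite Cnatnat_TE //; lia.
  by rewrite y0 // !linear0.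
have b0 : q = 0 -> pc_b x = 0 by move=> q0; subst q.
have b'0 : q = 0 -> pc_b' x = 0 by move=> q0; subst q.
rewrite /Cnatnat_delta; case: ifP => _; last by rewrite Tb // pc_bT.
by rewrite linearN Tb // pc_b'T.
Qed.

Fact Cnatnat_ST m (x : Cnatnat_mod C m.+2) :
  Cnatnat_uinv2 C m (Cnatnat_T C m.+2 x) = Cnatnat_T C m (Cnatnat_uinv2 C m x).
Proof.
move: x; apply: (Cnatnat_ext (f := Cnatnat_uinv2 C m \o Cnatnat_T C m.+2)
  (g := Cnatnat_T C m \o Cnatnat_uinv2 C m)) => p q x e /=.
rewrite Cnatnat_TE // Cnatnat_uinv2E // /Cnatnat_T_mono Cnatnat_uinv2E //.
by case: p e => [|[|p]] e /=; rewrite ?linear0 // Cnatnat_TE //; lia.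
Qed.

Definition Cnat : paraSModule k :=
  ParaSModule Cnat_T_bij Cnat_dd Cnat_dS Cnat_dT Cnat_ST.

Definition Cnatnat : paraSModule k :=
  ParaSModule Cnatnat_T_bij Cnatnat_dd Cnatnat_dS Cnatnat_dT Cnatnat_ST.

End HunitalTheory.

(* Main.v *)
Require Import Defs.
From mathcomp Require Import all_boot all_algebra.
From mathcomp Require Import zify.
Import GRing.Theory.
Local Open Scope ring_scope.

(** Both direct sums are generated by monomials x u^p, so every identity can be
    tested there, where it becomes an identity between b, b', tau, N and s'.
    Five facts do all the work: b (1 - tau) = (1 - tau) b', b' N = N b,
    b' s' + s' b' = 1, s' s' = 0, and s' N (1 - tau) s' = 0.  The last holds
    because N (1 - tau) = 1 - T and s' commutes with T, so that the composite
    equals (1 - T) s' s'.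

    The retraction is the elimination of the odd columns of the bicomplex: they
    carry the differential - b', which s' contracts.  The maps I, J and h are
    what this elimination produces.  I corrects an even monomial x u^(2p) by
    s' N x u^(2p-1), whose differential cancels the component N x of that of
    x u^(2p) up to s' b' N x = s' N b x, the correction needed for b x; J
    sends an odd monomial to the even column through (1 - tau) s'; and h is s'
    on odd monomials.  On an even monomial, I J - 1 is exactly the correction
    s' N x u^(2p-1), which is also h applied to N x u^(2p-1).  On an odd
    monomial, the sum of - b' s' and - s' b' cancels the identity and leaves
    (1 - tau) s' x u^(2p), which I sends to itself without correction, thanks
    to s' N (1 - tau) s' = 0 (lemma [I_mono_subtau_s']).

    That I commutes with the differentials is the homotopy relation at N x
    together with b' N = N b; that J does is the same relation at x, transported
    along 1 - tau, together with b (1 - tau) = (1 - tau) b'.  The special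
    conditions J h = 0, h I = 0 and h^2 = 0, as well as J I = 1, all come from
    s' s' = 0. *)

#[local] Arguments pc_b : simpl never.
#[local] Arguments pc_b' : simpl never.

(** * Evaluation on monomials *)

Section DeformationRetract.
Variables (k : pzRingType) (C : HunitalParaPrecyclic k).
Implicit Types (m p q : nat).

Lemma pc_b_deg0 q (x : C q) : q = 0%N -> pc_b x = 0.
Proof. by move=> q0; subst q. Qed.

Lemma pc_b'_deg0 q (x : C q) : q = 0%N -> pc_b' x = 0.
Proof. by move=> q0; subst q. Qed.

(** A face of an element of degree q lives in degree q.-1, which is the wrong
    degree when q = 0; but the face is then 0.  Allowing this case at once
    spares a distinction on q in each verification below. *)
Lemma uextE_face n (deg : nat -> nat) (V : lmodType k)
    (F : forall p q, C q -> V) (Flin : forall p q, linear (F p q))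
    p q (y : C q.-1) :
  (q = 0%N -> y = 0) -> ((0 < q)%N -> (p < n)%N && (q.-1 == deg p)) ->
  uext (n := n) (deg := deg) Flin (y *u^ p) = F p q.-1 y.
Proof.
move=> y0; have [/y0-> _ | _ inrange] := posnP q; last by rewrite uextE inrange.
have -> : F p q.-1 0 = 0.
  by have := Flin p q.-1 (-1) 0 0; rewrite scaler0 addr0 scaleN1r addNr.
by rewrite !linear0.
Qed.

Section OnFaces.
Variables (m p q : nat) (y : C q.-1).
Hypothesis y0 : q = 0%N -> y = 0.

Lemma mapI_faceE : (p.*2 + q)%N = m.+1 -> mapI C m (y *u^ p) = I_mono m p y.
Proof. by move=> e; apply: uextE_face => // q_gt0; lia. Qed.

Lemma mapJ_faceE : (p + q)%N = m.+1 -> mapJ C m (y *u^ p) = J_mono m p y.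
Proof. by move=> e; apply: uextE_face => // q_gt0; lia. Qed.

Lemma maph_faceE : (p + q)%N = m.+1 -> maph C m (y *u^ p) = h_mono m p y.
Proof. by move=> e; apply: uextE_face => // q_gt0; lia. Qed.
End OnFaces.

(** The differential, J and h are all given by separate formulas on even and
    on odd powers of u; writing the exponent as 2p or 2p+1 avoids any further
    reasoning on parity. *)
Lemma Cnatnat_ext_parity m (V : lmodType k)
    (f g : {linear Cnatnat_mod C m -> V}) :
  (forall p q (x : C q), (p.*2 + q)%N = m -> f (x *u^ p.*2) = g (x *u^ p.*2)) ->
  (forall p q (x : C q), (p.*2.+1 + q)%N = m ->
     f (x *u^ p.*2.+1) = g (x *u^ p.*2.+1)) ->
  f =1 g.
Proof.
move=> fg_even fg_odd; apply: Cnatnat_ext => p q x.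
rewrite -(odd_double_half p); case: (odd p); [exact: fg_odd | exact: fg_even].
Qed.

Section OnParity.
Variables (m p q : nat) (x : C q).

Lemma Cnatnat_dE0 : q = m.+1 -> Cnatnat_d C m (x *u^ 0) = pc_b x *u^ 0.
Proof. by move=> e; rewrite Cnatnat_dE // /Cnatnat_d_mono /= add0r. Qed.

Lemma Cnatnat_dE_even : (p.*2.+2 + q)%N = m.+1 ->
  Cnatnat_d C m (x *u^ p.*2.+2) = pcN x *u^ p.*2.+1 + pc_b x *u^ p.*2.+2.
Proof.
move=> e; rewrite Cnatnat_dE // /Cnatnat_d_mono.
by rewrite /Cnatnat_partial /Cnatnat_delta /= odd_double.
Qed.

Lemma Cnatnat_dE_odd : (p.*2.+1 + q)%N = m.+1 ->
  Cnatnat_d C m (x *u^ p.*2.+1)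
  = (x - pc_tau x) *u^ p.*2 - pc_b' x *u^ p.*2.+1.
Proof.
move=> e; rewrite Cnatnat_dE // /Cnatnat_d_mono.
by rewrite /Cnatnat_partial /Cnatnat_delta /= odd_double.
Qed.

Lemma I_monoS : I_mono m p.+1 x = x *u^ p.*2.+2 + hu_s' (pcN x) *u^ p.*2.+1.
Proof. by []. Qed.

Lemma J_mono_even : J_mono m p.*2 x = x *u^ p.
Proof. by rewrite /J_mono odd_double doubleK. Qed.

Lemma J_mono_odd :
  J_mono m p.*2.+1 x = (hu_s' x - pc_tau (hu_s' x)) *u^ p.
Proof. by rewrite /J_mono /= odd_double uphalf_double. Qed.

Lemma h_mono_even : h_mono m p.*2 x = 0.
Proof. by rewrite /h_mono odd_double. Qed.

Lemma h_mono_odd : h_mono m p.*2.+1 x = hu_s' x *u^ p.*2.+1.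
Proof. by rewrite /h_mono /= odd_double. Qed.
End OnParity.

(** * Consequences of the contraction *)

(** The correction term of I vanishes on the image of (1 - tau) s', because
    s' N (1 - tau) s' = (1 - T) s' s'. *)
Lemma I_mono_subtau_s' m p q (x : C q) :
  I_mono m p (hu_s' x - pc_tau (hu_s' x))
  = (hu_s' x - pc_tau (hu_s' x)) *u^ p.*2.
Proof. by case: p => [|p'] //; rewrite I_monoS hu_s'N_subtau linear0 addr0. Qed.

Lemma huB_subtau_s' q (x : C q) : huB (hu_s' x - pc_tau (hu_s' x)) = 0.
Proof. by rewrite /huB hu_s'N_subtau linear0 subrr. Qed.

(** On the image of J the B-part of the differential vanishes: this is what
    makes J compatible with the differentials on odd powers of u. *)
Lemma Cnat_d_subtau_s' m p q (x : C q) : (p.*2 + q)%N = m ->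
  Cnat_d C m ((hu_s' x - pc_tau (hu_s' x)) *u^ p)
  = pc_b (hu_s' x - pc_tau (hu_s' x)) *u^ p.
Proof.
move=> e; rewrite Cnat_dE /Cnat_d_mono; last by lia.
by case: p e => [|p] e; rewrite ?huB_subtau_s' ?linear0 addr0.
Qed.

(** The relation b' s' + s' b' = 1 cannot be stated for all q at once, since
    s' b' x has degree q.-1.+1 instead of q.  After applying a linear map
    defined in every degree, such as x |-> x u^p, both sides have the same type
    and the case q = 0, where b' = 0, needs no separate statement. *)
Lemma s'_homotopy_linear (V : lmodType k) (F : forall q, {linear C q -> V})
    q (x : C q) :
  F q (pc_b' (hu_s' x)) + F q.-1.+1 (hu_s' (pc_b' x)) = F q x.
Proof.
case: q x => [|q] x; last by rewrite -linearD /= hu_s'_homotopyS.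
by rewrite hu_s'_homotopy0 (pc_b'_deg0 _ x) // !linear0 addr0.
Qed.

(** * I is an S-map *)

Lemma mapI_d m (x : Cnat_mod C m.+1) :
  mapI C m (Cnat_d C m x) = Cnatnat_d C m (mapI C m.+1 x).
Proof.
move: x; apply: (Cnat_ext (f := mapI C m \o Cnat_d C m)
  (g := Cnatnat_d C m \o mapI C m.+1)) => p q x e /=.
rewrite Cnat_dE // mapIE // /Cnat_d_mono [LHS]linearD /=.
rewrite (mapI_faceE m p q) //; last exact: pc_b_deg0.
case: p e => [|p] e.
  by rewrite linear0 addr0 /I_mono Cnatnat_dE0.
rewrite mapIE ?I_mono_subtau_s' -/(huB x); last by lia.
rewrite !I_monoS [RHS]linearD /= Cnatnat_dE_even // Cnatnat_dE_odd; last by lia.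
(* Expand the component N x of d (x u^(2p+2)) as b' s' N x + s' b' N x: the
   first term cancels with the component of d (s' N x u^(2p+1)) on u^(2p+1),
   and b' N = N b identifies the second with the correction term of
   I (b x u^(p+1)). *)
rewrite -(s'_homotopy_linear _ (fun q => umono p.*2.+1) _ (pcN x)) /=.
rewrite pc_b'N -/(huB x).
rewrite [_ *u^ p.*2.+1 + _ *u^ p.*2.+1 + _]addrC -!addrA; congr (_ + _).
by rewrite [X in _ = X]addrCA; congr (_ + _); rewrite addrCA subrr addr0.
Qed.

Lemma mapI_S m (x : Cnat_mod C m.+2) :
  mapI C m (Cnat_uinv C m x) = Cnatnat_uinv2 C m (mapI C m.+2 x).
Proof.
move: x; apply: (Cnat_ext (f := mapI C m \o Cnat_uinv C m)
  (g := Cnatnat_uinv2 C m \o mapI C m.+2)) => p q x e /=.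
rewrite Cnat_uinvE // mapIE //.
case: p e => [|p] e; first by rewrite linear0 Cnatnat_uinv2E.
rewrite mapIE; last by lia.
rewrite I_monoS [RHS]linearD /= !Cnatnat_uinv2E; try lia.
by case: p {e} => [|p] //=; rewrite addr0.
Qed.

Lemma mapI_T m (x : Cnat_mod C m) :
  mapI C m (Cnat_T C m x) = Cnatnat_T C m (mapI C m x).
Proof.
move: x; apply: (Cnat_ext (f := mapI C m \o Cnat_T C m)
  (g := Cnatnat_T C m \o mapI C m)) => p q x e /=.
rewrite Cnat_TE // !mapIE //.
case: p e => [|p] e; first by rewrite Cnatnat_TE.
rewrite !I_monoS [RHS]linearD /= !Cnatnat_TE; try lia.
by rewrite /Cnatnat_T_mono pcNT hu_s'T.
Qed.

(** * J is an S-map *)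

Lemma mapJ_d m (x : Cnatnat_mod C m.+1) :
  mapJ C m (Cnatnat_d C m x) = Cnat_d C m (mapJ C m.+1 x).
Proof.
move: x; apply: (Cnatnat_ext_parity _ _ (mapJ C m \o Cnatnat_d C m)
  (Cnat_d C m \o mapJ C m.+1)) => p q x e /=.
  rewrite mapJE // J_mono_even Cnat_dE // /Cnat_d_mono.
  have bE : mapJ C m (pc_b x *u^ p.*2) = pc_b x *u^ p.
    by rewrite (mapJ_faceE m p.*2 q) ?J_mono_even //; apply: pc_b_deg0.
  case: p e bE => [|p] e bE; first by rewrite Cnatnat_dE0 ?bE ?addr0.
  rewrite doubleS Cnatnat_dE_even // [LHS]linearD /= bE mapJE; last by lia.
  by rewrite J_mono_odd addrC.
rewrite mapJE // J_mono_odd Cnat_d_subtau_s'; last by lia.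
rewrite Cnatnat_dE_odd // [LHS]linearB /= mapJE; last by lia.
rewrite (mapJ_faceE m p.*2.+1 q) //; last exact: pc_b'_deg0.
rewrite J_mono_even J_mono_odd pc_b_subtau.
(* What remains is (1 - tau) (b' s' + s' b') = 1 - tau. *)
apply/eqP; rewrite subr_eq; apply/eqP/esym.
exact: (s'_homotopy_linear _ (fun q => umono p \o (idfun \- @pc_tau k C q))).
Qed.

Lemma mapJ_S m (x : Cnatnat_mod C m.+2) :
  mapJ C m (Cnatnat_uinv2 C m x) = Cnat_uinv C m (mapJ C m.+2 x).
Proof.
move: x; apply: (Cnatnat_ext_parity _ _ (mapJ C m \o Cnatnat_uinv2 C m)
  (Cnat_uinv C m \o mapJ C m.+2)) => p q x e /=.
  rewrite mapJE // J_mono_even Cnatnat_uinv2E // Cnat_uinvE //.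
  case: p e => [|p] e; first exact: linear0.
  by rewrite /= mapJE ?J_mono_even //; lia.
rewrite mapJE // J_mono_odd Cnatnat_uinv2E // Cnat_uinvE; last by lia.
case: p e => [|p] e; first exact: linear0.
by rewrite /= mapJE ?J_mono_odd //; lia.
Qed.

Lemma mapJ_T m (x : Cnatnat_mod C m) :
  mapJ C m (Cnatnat_T C m x) = Cnat_T C m (mapJ C m x).
Proof.
move: x; apply: (Cnatnat_ext_parity _ _ (mapJ C m \o Cnatnat_T C m)
  (Cnat_T C m \o mapJ C m)) => p q x e /=; rewrite Cnatnat_TE // !mapJE //.
  by rewrite !J_mono_even Cnat_TE.
rewrite !J_mono_odd Cnat_TE; last by lia.
by rewrite /Cnat_T_mono hu_s'T -pcT_tauC -linearB.
Qed.

(** * I and J are mutually inverse up to the homotopy h *)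

Lemma mapJ_mapI m (x : Cnat_mod C m) : mapJ C m (mapI C m x) = x.
Proof.
move: x; apply: (Cnat_ext (f := mapJ C m \o mapI C m) (g := idfun))
  => p q x e /=.
rewrite mapIE //; case: p e => [|p] e; first by rewrite mapJE.
rewrite I_monoS [LHS]linearD /= !mapJE; try lia.
by rewrite (J_mono_even m p.+1) J_mono_odd hu_s's' linear0 subrr linear0 addr0.
Qed.

Lemma mapI_mapJ0 (x : Cnatnat_mod C 0) :
  mapI C 0 (mapJ C 0 x) = x + Cnatnat_d C 0 (maph C 0 x).
Proof.
move: x; apply: (Cnatnat_ext (f := mapI C 0 \o mapJ C 0)
  (g := idfun \+ (Cnatnat_d C 0 \o maph C 0))) => -[|p] [|q] x // e /=.
by rewrite mapJE // mapIE // maphE // linear0 addr0.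
Qed.

Lemma mapI_mapJS m (x : Cnatnat_mod C m.+1) :
  mapI C m.+1 (mapJ C m.+1 x)
  = x + Cnatnat_d C m.+1 (maph C m.+1 x) + maph C m (Cnatnat_d C m x).
Proof.
move: x; apply: (Cnatnat_ext_parity _ _ (mapI C m.+1 \o mapJ C m.+1)
  (idfun \+ (Cnatnat_d C m.+1 \o maph C m.+1) \+ (maph C m \o Cnatnat_d C m)))
  => p q x e /=.
  rewrite mapJE // J_mono_even mapIE // maphE // h_mono_even linear0 addr0.
  have bE : maph C m (pc_b x *u^ p.*2) = 0.
    by rewrite (maph_faceE m p.*2 q) ?h_mono_even //; apply: pc_b_deg0.
  case: p e bE => [|p] e bE; first by rewrite Cnatnat_dE0 // bE addr0.
  rewrite doubleS Cnatnat_dE_even // [maph _ _ _]linearD /= bE.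
  rewrite maphE; last by lia.
  by rewrite h_mono_odd addr0.
rewrite mapJE // J_mono_odd mapIE ?I_mono_subtau_s'; last by lia.
rewrite maphE // h_mono_odd Cnatnat_dE_odd ?addnS ?e //.
rewrite Cnatnat_dE_odd // [maph _ _ _]linearB /=.
rewrite maphE ?h_mono_even; last by lia.
rewrite (maph_faceE m p.*2.+1 q) //; last exact: pc_b'_deg0.
rewrite h_mono_odd sub0r.
rewrite -{1}(s'_homotopy_linear _ (fun q => umono p.*2.+1) _ x) /=.
by rewrite addrAC addrK addrC subrK.
Qed.

(** * Compatibility of h with S and T *)

Lemma maph_S1 (x : Cnatnat_mod C 1) : Cnatnat_uinv2 C 0 (maph C 1 x) = 0.
Proof.
move: x; apply: (Cnatnat_ext_parity _ _ (Cnatnat_uinv2 C 0 \o maph C 1) \0)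
  => p q x e /=; rewrite maphE //; first by rewrite h_mono_even linear0.
have -> : p = 0%N by lia.
by rewrite (h_mono_odd 1 0) Cnatnat_uinv2E //; lia.
Qed.

Lemma maph_S m (x : Cnatnat_mod C m.+2) :
  maph C m (Cnatnat_uinv2 C m x) = Cnatnat_uinv2 C m.+1 (maph C m.+2 x).
Proof.
move: x; apply: (Cnatnat_ext_parity _ _ (maph C m \o Cnatnat_uinv2 C m)
  (Cnatnat_uinv2 C m.+1 \o maph C m.+2)) => p q x e /=;
  rewrite maphE // Cnatnat_uinv2E //.
  rewrite h_mono_even linear0; case: p e => [|p] e; first exact: linear0.
  by rewrite /= maphE ?h_mono_even //; lia.
rewrite h_mono_odd Cnatnat_uinv2E; last by lia.
case: p e => [|p] e; first exact: linear0.
by rewrite /= maphE ?h_mono_odd //; lia.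
Qed.

Lemma maph_T m (x : Cnatnat_mod C m) :
  maph C m (Cnatnat_T C m x) = Cnatnat_T C m.+1 (maph C m x).
Proof.
move: x; apply: (Cnatnat_ext_parity _ _ (maph C m \o Cnatnat_T C m)
  (Cnatnat_T C m.+1 \o maph C m)) => p q x e /=;
  rewrite Cnatnat_TE // !maphE //.
  by rewrite !h_mono_even linear0.
by rewrite !h_mono_odd Cnatnat_TE ?hu_s'T //; lia.
Qed.

(** * The homotopy h is special *)

Lemma mapJ_maph m (x : Cnatnat_mod C m) : mapJ C m.+1 (maph C m x) = 0.
Proof.
move: x; apply: (Cnatnat_ext_parity _ _ (mapJ C m.+1 \o maph C m) \0)
  => p q x e /=; rewrite maphE //; first by rewrite h_mono_even linear0.
rewrite h_mono_odd mapJE; last by lia.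
by rewrite J_mono_odd hu_s's' linear0 subrr linear0.
Qed.

Lemma maph_mapI m (x : Cnat_mod C m) : maph C m (mapI C m x) = 0.
Proof.
move: x; apply: (Cnat_ext (f := maph C m \o mapI C m) (g := \0)) => p q x e /=.
rewrite mapIE //; case: p e => [|p] e; first by rewrite maphE.
rewrite I_monoS linearD /= !maphE; try lia.
by rewrite (h_mono_even m p.+1) h_mono_odd hu_s's' linear0 addr0.
Qed.

Lemma maph_maph m (x : Cnatnat_mod C m) : maph C m.+1 (maph C m x) = 0.
Proof.
move: x; apply: (Cnatnat_ext_parity _ _ (maph C m.+1 \o maph C m) \0)
  => p q x e /=; rewrite maphE //; first by rewrite h_mono_even linear0.
rewrite h_mono_odd maphE; last by lia.
by rewrite h_mono_odd hu_s's' linear0.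
Qed.

End DeformationRetract.

Theorem proposition8p3 (k : pzRingType) (C : HunitalParaPrecyclic k) :
  [/\ (* (1) *)
      @is_S_map k (Cnat C) (Cnatnat C) (mapI C) /\
      @is_S_map k (Cnatnat C) (Cnat C) (mapJ C),
      (* (2) *)
      [/\ forall m (x : Cnat C m), mapJ C m (mapI C m x) = x,
          @eq_1_add_boundary k (Cnatnat C)
            (fun m x => mapI C m (mapJ C m x)) (maph C)
        & @S_deformation_retract k (Cnatnat C) (Cnat C)
            (mapJ C) (mapI C) (maph C)]
    & (* (3) *)
      [/\ forall m (x : Cnatnat C m), mapJ C m.+1 (maph C m x) = 0,
          forall m (x : Cnat C m), maph C m (mapI C m x) = 0
        & forall m (x : Cnatnat C m), maph C m.+1 (maph C m x) = 0]].
Proof.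
have I_S_map : @is_S_map k (Cnat C) (Cnatnat C) (mapI C).
  by split=> m x; [exact: mapI_d | exact: mapI_S | exact: mapI_T].
have J_S_map : @is_S_map k (Cnatnat C) (Cnat C) (mapJ C).
  by split=> m x; [exact: mapJ_d | exact: mapJ_S | exact: mapJ_T].
have JI m (x : Cnat C m) : mapJ C m (mapI C m x) = x by exact: mapJ_mapI.
have IJ : @eq_1_add_boundary k (Cnatnat C)
    (fun m x => mapI C m (mapJ C m x)) (maph C).
  by split=> [x | m x]; [exact: mapI_mapJ0 | exact: mapI_mapJS].
split=> //; last first.
  by split=> m x; [exact: mapJ_maph | exact: maph_mapI | exact: maph_maph].
split=> //; split=> //; split; last by move=> m x; exact: maph_T.
by split=> [x | m x]; [exact: maph_S1 | exact: maph_S].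
Qed.
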